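(* Let $B$ be a flat-top front on $\omega$, $\vec{\mathcal{U}}=(\mathcal{U}_c:c\in\hat B^-)$ a sequence of nonprincipal p-points on $\omega$, and $\mathcal{U}$ the ultrafilter on $B$ generated by the $\vec{\mathcal{U}}$-trees (this is the representation of a Fubini iterate of p-points). Let $\mathcal{V}$ be a q-point with $\mathcal{V}\le_T\mathcal{U}$. Then there exist $\tilde T\in\mathfrak{T}$ and a finite-to-one function $\tau:\tilde T\to\omega$ such that $\{\tau(T): T\in\mathfrak{T},\ T\subseteq\tilde T\}\subseteq\mathcal{V}$, where $\tau(T)=\{\tau(a):a\in T\}$.
   Context: For finite $a,b\subseteq\omega$, $a\sqsubseteq b$ means $a$ is an initial segment of $b$ in increasing enumeration. A front on $\omega$ is $B\subseteq[\omega]^{<\omega}$ with no $a\sqsubset b$ (proper initial segment) for $a,b\in B$ such that every infinite $X\subseteq\omega$ has an initial segment in $B$. $B$ is a flat-top front if it is a front, $B\ne\{\emptyset\}$, and either $B=[\omega]^1$ or $B\subseteq[\omega]^{\ge2}$ and for each $b\in B$, with $a=b\setminus\{\max b\}$, $\{c\setminus a:c\in B, c\sqsupset a\}=\{\{n\}:n>\max a\}$. $\hat B$ is the set of initial segments of members of $B$, $\hat B^-=\hat B\setminus B$. A $\vec{\mathcal{U}}$-tree is a $\sqsubseteq$-downward closed $T\subseteq\hat B$ containing $\emptyset$ such that for each $c\in T\cap\hat B^-$, $\{n:c\cup\{n\}\in T\}\in\mathcal{U}_c$; $\mathfrak{T}$ is the set of them, $[T]=T\cap B$, and $\mathcal{U}=\{X\subseteq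 B:\exists T\in\mathfrak{T}\,([T]\subseteq X)\}$. A p-point is an ultrafilter on $\omega$ such that every decreasing sequence of its members has a member almost contained in each; a q-point is a nonprincipal ultrafilter on $\omega$ such that for every partition of $\omega$ into finite pieces some member meets each piece in at most one point. $\mathcal{V}\le_T\mathcal{U}$ iff there is a map $\mathcal{U}\to\mathcal{V}$ sending cofinal subsets of $(\mathcal{U},\supseteq)$ to cofinal subsets of $(\mathcal{V},\supseteq)$. *)

(* Defs.v *)
From mathcomp Require Export all_boot finmap.
From mathcomp Require Export all_classical.

Set Implicit Arguments.
Unset Strict Implicit.
Unset Printing Implicit Defensive.

Local Open Scope classical_set_scope.

(* Finite subsets of omega are {fset nat}; the second argument is a set nat so
   that the same notion covers initial segments of infinite sets *)
Definition init_seg (a : {fset nat}) (X : set nat) : Prop :=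
  [set` a] `<=` X /\ forall m n : nat, n \in a -> X m -> m < n -> m \in a.

Definition proper_init_seg (a b : {fset nat}) : Prop :=
  init_seg a [set` b] /\ a <> b.

Definition front (B : set {fset nat}) : Prop :=
  (forall a b, B a -> B b -> ~ proper_init_seg a b) /\
  (forall X : set nat, infinite_set X -> exists2 b, B b & init_seg b X).

(* junk value 0 on the empty set, never reached in flat_top_front *)
Definition fmax (a : {fset nat}) : nat := \max_(n <- a) n.

Definition flat_top_front (B : set {fset nat}) : Prop :=
  [/\ front B,
      B <> [set fset0] &
      B = [set b | #|` b| = 1] \/
      (B `<=` [set b | 2 <= #|` b|] /\
       forall b, B b -> let a := (b `\ fmax b)%fset in
         [set (c `\` a)%fset | c in [set c | B c /\ proper_init_seg a c]] =
         [set [fset n]%fset | n in [set n | fmax a < n]])].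

Definition hat (B : set {fset nat}) : set {fset nat} :=
  [set a | exists2 b, B b & init_seg a [set` b]].

Definition hatm (B : set {fset nat}) : set {fset nat} := hat B `\` B.

(* Only the values U c at c in hatm B matter *)
Definition Utree (B : set {fset nat}) (U : {fset nat} -> set_system nat)
    (T : set {fset nat}) : Prop :=
  [/\ T `<=` hat B,
      T fset0,
      (forall a b, T b -> init_seg a [set` b] -> T a) &
      (forall c, T c -> hatm B c -> U c [set n | T (n |` c)%fset])].

(* An ultrafilter on the set B, presented as a family of subsets of B; it is not
   a filter on the whole type {fset nat} *)
Definition tree_ultrafilter (B : set {fset nat})
    (U : {fset nat} -> set_system nat) : set_system {fset nat} :=
  [set X | X `<=` B /\ exists2 T, Utree B U T & T `&` B `<=` X].

Definition nonprincipal (F : set_system nat) : Prop :=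
  forall n, F <> principal_filter n.

Definition p_point (F : set_system nat) : Prop :=
  UltraFilter F /\
  forall A : nat -> set nat,
    (forall n, F (A n)) -> (forall n, A n.+1 `<=` A n) ->
    exists2 X, F X & forall n, finite_set (X `\` A n).

Definition q_point (F : set_system nat) : Prop :=
  [/\ UltraFilter F,
      nonprincipal F &
      forall P : set (set nat),
        classical_sets.partition P id [set: nat] ->
        (forall p, P p -> finite_set p) ->
        exists2 X, F X & forall p, P p -> is_subset1 (X `&` p)].

(* C is cofinal in the poset (F, reverse inclusion) *)
Definition cofinal_in (S : Type) (F C : set_system S) : Prop :=
  C `<=` F /\ forall A, F A -> exists2 D, C D & D `<=` A.

Definition tukey_le (S1 S2 : Type) (G : set_system S2) (F : set_system S1) :
    Prop :=
  exists f : set S1 -> set S2,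
    (forall A, F A -> G (f A)) /\
    (forall C, cofinal_in F C -> cofinal_in G (f @` C)).

Definition finite_to_one_on (S1 S2 : Type) (D : set S1) (f : S1 -> S2) : Prop :=
  forall y, finite_set (D `&` f @^-1` [set y]).

(* Main.v *)
(** Replacing the cofinal map by a monotone one gives a monotone [phi] on trees
    such that every [phi T] is in [V] and every member of [V] contains some
    [phi T]. As [V] is an ultrafilter, it suffices to find a finite-to-one [tau]
    such that [tau @` T] meets [phi T] for every tree [T] inside [Tt].

    For a finite set [s] of nodes let [psi s] be the set of numbers lying in
    [phi T] for every tree [T] containing [s]. A fusion over the p-points, in
    which all nodes leave common gaps above infinitely many [n], yields a tree
    [Tt] such that, for [T] inside [Tt], any [k] in [phi T] is already in [psi] of
    the trace of [T] below some [m k]. The least trace of [T] with nonempty [psi]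
    provides a node [a] of [T] and a number [k] of [phi T], each bounding the
    other. A member [W] of the q-point [V], sparse with respect to these bounds,
    contains at most one such [k] for each [a], and this [k] is taken as
    [tau a]. *)

From mathcomp Require Import zify.
Require Import Defs.

Set Implicit Arguments.
Unset Strict Implicit.

Local Open Scope classical_set_scope.

(** * Finite bounds and tails of ultrafilters *)

Lemma uniform_bound (I : eqType) (s : seq I) (P : I -> nat -> Prop) :
  (forall i m n, m <= n -> P i m -> P i n) ->
  (forall i, i \in s -> exists n, P i n) ->
  exists n, forall i, i \in s -> P i n.
Proof.
move=> Pmon; elim: s => [|x s IHs] Ps; first by exists 0.
have [|n Pn] := IHs; first by move=> i si; apply: Ps; rewrite inE si orbT.
have [m Pm] := Ps x (mem_head _ _); exists (maxn m n) => i.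
rewrite inE => /predU1P[->|/Pn]; first exact: Pmon (leq_maxl _ _) Pm.
exact/Pmon/leq_maxr.
Qed.

Lemma nonprincipal_tail (F : set_system nat) : UltraFilter F ->
  nonprincipal F -> forall n, F [set x | n <= x].
Proof.
move=> FU Fnp; have Fn1 n : F (~` [set n]).
  have [F1|//] := in_ultra_setVsetC [set n] FU.
  case: (Fnp n); apply/seteqP; split=> A.
    move=> FA; apply/principal_filterP.
    by have [x [Ax <-]] := filter_ex (filterI FA F1).
  by move=> /principal_filterP An; apply: filterS F1 => _ ->.
elim=> [|n IHn]; first by apply: filterS filterT.
apply: filterS (filterI IHn (Fn1 n)) => x [/= nx] /eqP; lia.
Qed.

(** * Interval partitions, sparse sets and common gaps *)

Section Blocks.
Variable p : nat -> nat.
Hypothesis p_lt : forall i, p i < p i.+1.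

Lemma blocks_le i j : i <= j -> p i <= p j.
Proof.
by apply: (homo_leq (r := leq)) => // [? ? ?|k]; [exact: leq_trans|exact/ltnW].
Qed.

Lemma blocks_cover : p 0 = 0 -> forall x, exists i, p i <= x < p i.+1.
Proof.
move=> p0; elim=> [|x [i /andP[ix xi]]].
  by exists 0; rewrite p0 -[X in X < _]p0 p_lt.
have [xi'|ix'] := ltnP x.+1 (p i.+1); first by exists i; lia.
by exists i.+1; have := p_lt i.+1; lia.
Qed.

Lemma blocks_inj i j x :
  p i <= x < p i.+1 -> p j <= x < p j.+1 -> i = j.
Proof.
move=> xi xj; case: (ltngtP i j) => // ij; have := blocks_le ij; lia.
Qed.

End Blocks.

(* Blocks of even index and blocks of odd index each leave a whole block between
   two consecutive points, and one of the two unions is in the ultrafilter. *)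
Lemma q_point_sparse (V : set_system nat) (H : nat -> nat) : q_point V ->
  exists2 W, V W & forall k k', W k -> W k' -> k < k' -> H k < k'.
Proof.
(* Each [p i.+1] exceeds [k] and [H k] for all [k <= p i], so points separated by a whole block
   satisfy the required inequality. *)
case=> VU _ Vq; pose p i := iter i (fun n => (\max_(k < n.+1) maxn k (H k)).+1) 0.
have pH i k : k <= p i -> maxn k (H k) < p i.+1.
  by move=> ki; rewrite /p iterS ltnS (leq_bigmax (Ordinal (ki : k < (p i).+1))).
have p_lt i : p i < p i.+1 by have := pH i _ (leqnn _); lia.
have p0 : p 0 = 0 by [].
pose J i := [set x | p i <= x < p i.+1].
have [||X VX X1] := Vq (range J).
- split=> [|A C [i _ <-] [j _ <-] [x [xi xj]]|_ [i _ <-]].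
  + apply/seteqP; split=> // x _; have [i xi] := blocks_cover p_lt p0 x.
    by exists (J i); first exists i.
  + by rewrite (blocks_inj p_lt xi xj).
  + by exists (p i); rewrite /J /= leqnn p_lt.
- move=> _ [i _ <-]; apply: sub_finite_set (finite_II (p i.+1)) => x.
  by move=> /andP[].
have XJ i k k' : X k -> X k' -> J i k -> J i k' -> k = k'.
  by move=> ? ? ? ?; apply: (X1 (J i)) => //; exists i.
have sparse (e : bool) k k' :
    X k -> X k' -> (exists2 i, odd i = e & J i k) ->
    (exists2 i, odd i = e & J i k') -> k < k' -> H k < k'.
  move=> Xk Xk' [i oi ik] [j oj jk'] kk'.
  have ij : i <> j.
    by move=> ij; rewrite -ij in jk'; have := XJ i k k' Xk Xk' ik jk'; lia.
  have ltij : i < j.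
    rewrite ltnNge; apply/negP => ji; have ji' : j.+1 <= i by lia.
    by have := blocks_le p_lt ji'; move/andP: ik; move/andP: jk'; lia.
  have i2j : i.+2 <= j by lia.
  move/andP: ik => [_ /ltnW ki]; have := pH _ _ ki; have := blocks_le p_lt i2j.
  by move/andP: jk'; lia.
pose E := [set x | exists2 i, odd i = false & J i x].
have [VE|VE] := in_ultra_setVsetC E VU.
  exists (X `&` E); first exact: filterI.
  by move=> k k' [? ?] [? ?]; exact: (sparse false).
have EC x : (~` E) x -> exists2 i, odd i = true & J i x.
  move=> Ex; have [i xi] := blocks_cover p_lt p0 x; exists i => //.
  by apply/negP => /negP/negbTE oi; apply: Ex; exists i.
exists (X `&` ~` E); first exact: filterI.
by move=> k k' [? /EC ?] [? /EC ?]; exact: (sparse true).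
Qed.

(* [G] follows residues [r j] modulo [2 ^ j]: of the two lifts of [r j] modulo
   [2 ^ j.+1] at most one has the union of its blocks in [F j], and [r j.+1] is
   the other one. *)
Lemma common_gaps (P : set nat) (F : nat -> set_system nat) (p : nat -> nat) :
  (forall j, P j -> UltraFilter (F j) /\ nonprincipal (F j)) ->
  (forall i, p i < p i.+1) ->
  exists2 G : set nat, forall n, exists2 i, G i & n <= i &
    forall j, P j -> F j [set x | forall i, G i -> ~ p i <= x < p i.+1].
Proof.
move=> PF p_lt.
pose C r j := [set x | exists2 i, i = r %[mod 2 ^ j] & p i <= x < p i.+1].
pose r := fix r j := if j is j'.+1 then
  if `[< F j' (C (r j') j'.+1) >] then r j' + 2 ^ j' else r j' else 0.
have r_lt j : r j < 2 ^ j.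
  by elim: j => //= j IHj; rewrite expnS; case: asboolP => _; lia.
have rE j l : j <= l -> r l = r j %[mod 2 ^ j].
  elim: l => [|l IHl]; first by rewrite leqn0 => /eqP ->.
  rewrite leq_eqVlt => /predU1P[-> //|]; rewrite ltnS => jl /=; rewrite -(IHl jl).
  case: asboolP => // _; rewrite -(subnKC jl) expnD -modnDmr.
  by rewrite modnMr addn0.
have rF j : P j -> ~ F j (C (r j.+1) j.+1).
  move=> Pj; have [FU _] := PF j Pj; rewrite /=; case: asboolP => // FC FC'.
  have [x [[i ir xi] [i' ir' xi']]] := filter_ex (filterI FC FC').
  have ii' := blocks_inj p_lt xi xi'; move: ir'; rewrite -ii' ir.
  have := r_lt j; have := expnS 2 j; have : 0 < 2 ^ j by rewrite expn_gt0.
  by move=> ? ? ?; rewrite !modn_small; lia.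
(* The summand [2 ^ j] makes the set unbounded. For [l > j] the index [r l + 2 ^ l] is congruent to
   [r j.+1] modulo [2 ^ j.+1], so its block lies in a set outside [F j]; the finitely many other
   blocks lie below [M]. *)
exists (range (fun j => r j + 2 ^ j)) => [n|j Pj].
  by exists (r n + 2 ^ n); [exists n|have := ltn_expl n (isT : 1 < 2); lia].
have [FU Fnp] := PF j Pj.
have FnC : F j (~` C (r j.+1) j.+1).
  by have [/(rF j Pj)|] := in_ultra_setVsetC (C (r j.+1) j.+1) FU.
have [|l _|M Mj] := @uniform_bound _ (iota 0 j.+1) (fun l n => p (r l + 2 ^ l).+1 <= n).
- by move=> l m n mn pm; exact: leq_trans pm mn.
- by exists (p (r l + 2 ^ l).+1).
apply: filterS (filterI FnC (nonprincipal_tail FU Fnp M)) => x [xC Mx] _ [l _ <-] xl.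
have [lj|jl] := leqP l j.
  by have := Mj l; rewrite mem_iota add0n ltnS => /(_ lj); move: Mx xl => /=; lia.
apply: xC; exists (r l + 2 ^ l) => //.
by rewrite -(rE _ _ jl) -(subnKC jl) expnD -modnDmr modnMr addn0.
Qed.

(** * Truncations and initial segments of finite sets *)

(* Strict upper bound: [rk a <= n] means that [a] is a subset of [0, n). *)
Definition rk (a : {fset nat}) : nat := \max_(x <- a) x.+1.

Definition cut (n : nat) (a : {fset nat}) : {fset nat} :=
  [fset x in a | x < n]%fset.

Lemma rkP (a : {fset nat}) n :
  reflect (forall x, x \in a -> x < n) (rk a <= n).
Proof.
apply: (iffP (bigmax_leqP_seq _ _ _ _)) => [an x ax|an x ax _]; exact: an.
Qed.

Lemma rk0 : rk fset0 = 0.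
Proof. by apply/eqP; rewrite -leqn0; apply/rkP => x; rewrite inE. Qed.

Lemma finite_rk n : finite_set [set a | rk a <= n].
Proof.
apply: sub_finite_set (finite_fset (fpowerset [fset x in iota 0 n]%fset)).
move=> a /rkP an; rewrite /= fpowersetE; apply/fsubsetP => x /an.
by rewrite inE /= mem_iota.
Qed.

Lemma cut_id n a : rk a <= n -> cut n a = a.
Proof.
move/rkP=> an; apply/fsetP => x; rewrite !inE /=.
by case: (boolP (x \in a)) => // /an ->.
Qed.

Lemma cut_fsetU1 n x a : n <= x -> cut n (x |` a)%fset = cut n a.
Proof.
move=> nx; apply/fsetP => y; rewrite !inE /=; case: eqP => [->|//].
by rewrite ltnNge nx !andbF.
Qed.

Lemma rk_cut n a : rk (cut n a) <= n.
Proof. by apply/rkP => x; rewrite !inE /= => /andP[]. Qed.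

Lemma init_seg_cut n a : init_seg (cut n a) [set` a].
Proof.
split=> [x|x y]; rewrite /= !inE /= => /andP[ay yn //] ax xy.
by rewrite ax (ltn_trans xy yn).
Qed.

Lemma init_seg0 X : init_seg fset0 X.
Proof. by split=> [x|x y]; rewrite /= inE. Qed.

Lemma init_seg_refl (a : {fset nat}) : init_seg a [set` a].
Proof. by split. Qed.

Lemma init_seg_trans (a b : {fset nat}) X :
  init_seg a [set` b] -> init_seg b X -> init_seg a X.
Proof.
move=> [ab abi] [bX bXi]; split=> [x /ab/bX //|m n na Xm mn].
exact: (abi m n) (bXi m n (ab _ na) Xm mn) mn.
Qed.

Lemma init_seg_anti (a b : {fset nat}) :
  init_seg a [set` b] -> init_seg b [set` a] -> a = b.
Proof.
by move=> [ab _] [ba _]; apply/fsetP => x; apply/idP/idP; [exact: ab|exact: ba].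
Qed.

Lemma init_seg_fsetU1 (a c : {fset nat}) x : rk c <= x ->
  init_seg a [set` (x |` c)%fset] -> init_seg a [set` c] \/ a = (x |` c)%fset.
Proof.
move=> /rkP cx [axc ai]; have [xa|xa] := boolP (x \in a).
  right; apply: init_seg_anti; first by split.
  split=> [y /fset1UP[->//|cy]|m n nc am mn].
    by apply: ai xa _ (cx y cy); rewrite /= !inE cy orbT.
  exact: axc.
left; split=> [y /= ay|m n na cm mn].
  by have /fset1UP[yx|//] := axc _ ay; rewrite yx (negbTE xa) in ay.
by apply: ai na _ mn; rewrite /= !inE cm orbT.
Qed.

(** * Trees on a front *)

Section Front.
Variable B : set {fset nat}.
Hypothesis frontB : front B.

Lemma hat_init_seg a b : hat B b -> init_seg a [set` b] -> hat B a.
Proof. by move=> [b' Bb' bb'] ab; exists b' => //; exact: init_seg_trans bb'. Qed.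

Lemma hat0 : hat B fset0.
Proof.
have [b Bb _] := frontB.2 _ infinite_nat.
by exists b => //; exact: init_seg0.
Qed.

(** The front has a member that is an initial segment of [X]. If it contains [x], it extends the new
    node; otherwise it is an initial segment of [c], and the antichain property would put [c] in
    [B]. *)
Lemma hat_fsetU1 c x : hatm B c -> rk c <= x -> hat B (x |` c)%fset.
Proof.
move=> [[b' Bb' cb'] nBc] /rkP cx.
pose X := [set y | y \in (x |` c)%fset \/ x < y].
have Xinf : infinite_set X.
  move=> Xfin; apply: infinite_nat.
  apply: sub_finite_set (_ : finite_set (`I_x.+1 `|` X)).
    by move=> y _ /=; rewrite ltnS; have [?|?] := leqP y x; [left|right; right].
  by rewrite finite_setU; split=> //; exact: finite_II.
have [b Bb [bX bi]] := frontB.2 X Xinf.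
have Xc y : y \in c -> X y by move=> cy; left; rewrite !inE cy orbT.
have Xx : X x by left; rewrite !inE eqxx.
have [xb|xb] := boolP (x \in b).
  exists b => //; split=> [y /fset1UP[->//|cy]|m n nxc bm mn].
    exact: bi xb (Xc _ cy) (cx _ cy).
  have [//|xm] := bX _ bm.
  by case/fset1UP: nxc => [nx|/cx nx]; lia.
have bc : init_seg b [set` c].
  split=> [y /= bny|m n nb cm mn]; last exact: bi nb (Xc _ cm) mn.
  have [/fset1UP[yx|//]|xy] := bX _ bny; first by rewrite yx (negbTE xb) in bny.
  by rewrite (bi _ _ bny Xx xy) in xb.
have bb' : b = b'.
  apply: contrapT => bb'; apply: (frontB.1 _ _ Bb Bb'); split=> //.
  exact: init_seg_trans cb'.
by case: nBc; rewrite -(init_seg_anti bc) // bb'.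
Qed.

Variable U : {fset nat} -> set_system nat.
Hypothesis Unp : forall c, hatm B c -> nonprincipal (U c) /\ p_point (U c).

Let Uultra c : hatm B c -> UltraFilter (U c).
Proof. by move=> /Unp[_ []]. Qed.

Let Utail c n : hatm B c -> U c [set x | n <= x].
Proof. by move=> Bc; have [cnp [cU _]] := Unp Bc; exact: nonprincipal_tail. Qed.

Lemma Utree_hat : Utree B U (hat B).
Proof.
split=> //; [exact: hat0 | by move=> a b; exact: hat_init_seg |].
move=> c _ Bc; have cU := Uultra Bc.
by apply: filterS (Utail (rk c) Bc) => x; exact: hat_fsetU1.
Qed.

Lemma Utree_setI T T' : Utree B U T -> Utree B U T' -> Utree B U (T `&` T').
Proof.
move=> [TB T0 Td TU] [T'B T'0 T'd T'U]; split=> //.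
- by move=> a [/TB].
- by move=> a b [Tb T'b] ab; split; [exact: Td ab|exact: T'd ab].
- move=> c [Tc T'c] Bc; have cU := Uultra Bc.
  exact: filterI (TU c Tc Bc) (T'U c T'c Bc).
Qed.

(** * Numbers forced by finite sets of nodes *)

Variable phi : set {fset nat} -> set nat.
Hypothesis phi_mon : forall T T', T `<=` T' -> phi T `<=` phi T'.
Hypothesis phi_neq0 : forall T, Utree B U T -> phi T !=set0.
Hypothesis phi_avoid : forall k, exists2 T, Utree B U T & ~ phi T k.

Let psi (s : {fset {fset nat}}) : set nat :=
  [set k | forall T, Utree B U T -> [set` s] `<=` T -> phi T k].

Let psi_mon (s s' : {fset {fset nat}}) : (s `<=` s')%fset -> psi s `<=` psi s'.
Proof. by move=> /fsubsetP ss' k ks T TU s'T; apply: ks => // a /ss'/s'T. Qed.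

Let D n : {fset {fset nat}} := fset_set [set a | hat B a /\ rk a <= n].

Let in_D n a : (a \in D n) <-> (hat B a /\ rk a <= n).
Proof.
rewrite in_fset_set; first by split; [move/set_mem|exact: mem_set].
by apply: sub_finite_set (finite_rk n) => b [].
Qed.

Let tr n (T : set {fset nat}) : {fset {fset nat}} := [fset a in D n | `[< T a >]]%fset.

Let in_tr n T a : (a \in tr n T) <-> (a \in D n /\ T a).
Proof.
by rewrite !inE /=; split=> [/andP[-> /asboolP]|[-> /asboolP]].
Qed.

Let tr_D n T : (tr n T `<=` D n)%fset.
Proof. by apply/fsubsetP => a /in_tr[]. Qed.

(** Each [k] outside [psi s] is omitted by some tree containing [s]; by monotonicity the
    intersection of these trees for [k <= n] omits them all. *)
Let avoiding_tree n (s : {fset {fset nat}}) : [set` s] `<=` hat B ->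
  exists T, [/\ Utree B U T, [set` s] `<=` T &
    forall k, k <= n -> phi T k -> psi s k].
Proof.
move=> sB.
have one k : exists T, [/\ Utree B U T, [set` s] `<=` T & phi T k -> psi s k].
  have [ks|nks] := pselect (psi s k).
    by exists (hat B); split=> //; exact: Utree_hat.
  move/existsNP: nks => [T /not_implyP[TU /not_implyP[sT nTk]]].
  by exists T; split.
elim: n => [|n [T [TU sT Tn]]].
  by have [T [TU sT T0]] := one 0; exists T; split=> // k; rewrite leqn0 => /eqP ->.
have [T' [T'U sT' T'n]] := one n.+1; exists (T `&` T'); split.
- exact: Utree_setI.
- by move=> a sa; split; [exact: sT|exact: sT'].
- move=> k; rewrite leq_eqVlt => /predU1P[->|kn] kTT'.
    by apply: T'n; apply: phi_mon kTT' => a [].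
  by apply: (Tn k) => //; apply: phi_mon kTT' => a [].
Qed.

(** * Fusion over the p-points *)

Section Fusion.
Variable Ts : nat -> {fset {fset nat}} -> set {fset nat}.
Hypothesis TsU : forall n s, (s `<=` D n)%fset -> Utree B U (Ts n s).
Hypothesis Ts_sub : forall n s, (s `<=` D n)%fset -> [set` s] `<=` Ts n s.

(** Pointwise form of an inclusion: a tree [T] all of whose nodes satisfy [Q n] lies inside
    [Ts n (tr n T)]. *)
Let Q n a := forall s : {fset {fset nat}},
  (s `<=` D n)%fset -> cut n a \in s -> Ts n s a.

Let Q_rk n a : rk a <= n -> Q n a.
Proof. by move=> an s sD; rewrite cut_id //; exact: Ts_sub. Qed.

(** Only finitely many [s] occur, and adding some [x >= n] leaves [cut n c] unchanged. *)
Let Q_fsetU1 n c : hatm B c -> Q n c -> U c [set x | Q n (x |` c)%fset].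
Proof.
move=> Bc Qc; have cU := Uultra Bc.
pose E (s : {fset {fset nat}}) := [set x | cut n c \in s -> Ts n s (x |` c)%fset].
have UE : U c (\bigcap_(s in [set` fpowerset (D n)]) E s).
  apply: filter_bigI => s; rewrite fpowersetE => sD.
  have [cs|cs] := boolP (cut n c \in s); last first.
    by apply: filterS filterT => x _; rewrite /E /= (negbTE cs).
  have [_ _ _ TU] := TsU sD.
  by apply: filterS (TU c (Qc s sD cs) Bc) => x xT _.
apply: filterS (filterI UE (Utail n Bc)) => x [xE nx] s sD.
by rewrite cut_fsetU1 //; apply: xE; rewrite /= fpowersetE.
Qed.

(** The p-point property gives one [Y] almost contained in every [A n]; [g n] bounds the exceptions
    to [A n.+1], the first of these sets to control level [n]. Levels below [rk c] are left out, as
    [Q i c] is automatic only for [rk c <= i]. *)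
Let pseudo_intersection c : hatm B c -> exists Y g, U c Y /\
  forall n x, rk c <= n -> Y x -> g n <= x -> Q n (x |` c)%fset.
Proof.
move=> Bc; have [_ [cU cP]] := Unp Bc.
pose A n := [set x | forall i, rk c <= i < n -> Q i (x |` c)%fset].
have UA1 i : rk c <= i -> U c [set x | Q i (x |` c)%fset].
  by move=> ci; apply: Q_fsetU1 => //; exact: Q_rk.
have UA n : U c (A n).
  have UAi i : i \in [fset i in iota 0 n]%fset ->
      U c [set x | rk c <= i -> Q i (x |` c)%fset].
    move=> _; have [ci|ci] := leqP (rk c) i; first by apply: filterS (UA1 i ci) => x xQ _.
    by apply: filterS filterT.
  apply: filterS (filter_bigI _ UAi) => x xA i /andP[ci i_n].
  by apply: xA ci; rewrite /= inE /= mem_iota.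
have [|Y UY YA] := cP A UA.
  by move=> n x xA i /andP[ci i_n]; apply: xA; rewrite ci leqW.
have /choice[g gY] n : exists g, forall x, (Y `\` A n.+1) x -> x < g.
  have [||g gY] := @uniform_bound _ (fset_set (Y `\` A n.+1)) (fun x m => x < m).
  - by move=> x m m' mm' xm; exact: leq_trans mm'.
  - by move=> x _; exists x.+1.
  - by exists g => x YAx; apply: gY; rewrite in_fset_set ?inE.
exists Y, g; split=> // n x cn Yx gx.
have : A n.+1 x by apply: contrapT => nAx; have := gY n x (conj Yx nAx); lia.
by apply; rewrite cn leqnn.
Qed.

(* [Q n] holds at [x |` c] for all [x] beyond [gm n], so it suffices that no
   successor of [c] falls in the block [[p i, p i.+1)] when [n = p i] is in [N].
   The same blocks have to be avoided at every node [c]. *)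
Lemma fusion_tree : exists (Tt : set {fset nat}) (N : set nat),
  [/\ Utree B U Tt, forall n, exists2 m, N m & n <= m &
      forall n a, N n -> Tt a -> Q n a].
Proof.
have /choice[Y /choice[g Yg]] c : exists Y g, hatm B c -> U c Y /\
    forall n x, rk c <= n -> Y x -> g n <= x -> Q n (x |` c)%fset.
  have [Bc|nBc] := pselect (hatm B c).
    by have [Y [g Yg]] := pseudo_intersection Bc; exists Y, g.
  by exists setT, id => /nBc.
have /choice[gm gmP] n : exists gm, forall c, c \in D n -> g c n <= gm.
  apply: (@uniform_bound _ (D n) (fun c m => g c n <= m)) => [c m m' mm' cm|c _].
    exact: leq_trans mm'.
  by exists (g c n).
pose p i := iter i (fun n => maxn n.+1 (gm n)) 0.
have pS i : p i.+1 = maxn (p i).+1 (gm (p i)) by [].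
have p_lt i : p i < p i.+1 by rewrite pS leq_maxl.
have p_ge i : i <= p i by elim: i => // i /leq_ltn_trans; apply.
(* Coding nodes by numbers turns the family [U c] into a sequence. *)
pose F j : set_system nat := if choice.unpickle j is Some c then U c else set0.
have FE c : F (choice.pickle c) = U c by rewrite /F choice.pickleK.
have [|G Ginf GF] := @common_gaps (@choice.pickle _ @` hatm B) F p _ p_lt.
  move=> _ [c Bc <-]; rewrite FE.
  by split; [exact: Uultra|case: (Unp Bc)].
have Ugap c : hatm B c -> U c [set x | forall i, G i -> ~ p i <= x < p i.+1].
  by move=> Bc; rewrite -FE; apply: GF; exists c.
(* Quantifying over initial segments makes [Tt] downward closed. *)
pose Tt := [set a | hat B a /\
  forall b i, init_seg b [set` a] -> G i -> Q (p i) b].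
exists Tt, (p @` G); split.
- split=> [a []//||a b [Bb bQ] ab|c [Bc cQ] Bc'].
  + split=> [|b i b0 Gi]; first exact: hat0.
    apply: Q_rk; suff -> : b = fset0 by rewrite rk0.
    by apply: init_seg_anti => //; exact: init_seg0.
  + split=> [|a' i a'a]; first exact: hat_init_seg ab.
    by apply: bQ; exact: init_seg_trans ab.
  + have cU := Uultra Bc'; have [UY YQ] := Yg c Bc'.
    have Usmall : U c (\bigcap_(i in [set` [fset i in iota 0 (rk c)]%fset])
        [set x | G i -> Q (p i) (x |` c)%fset]).
      apply: filter_bigI => i _; have [Gi|nGi] := pselect (G i); last first.
        by apply: filterS filterT => x _ /nGi.
      by apply: filterS (Q_fsetU1 Bc' (cQ c i (init_seg_refl c) Gi)) => x xQ _.
    apply: filterS (filterI (filterI UY Usmall)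
      (filterI (Ugap c Bc') (Utail (rk c) Bc'))) => x [[Yx xs] [xG cx]].
    split=> [|b i bxc Gi]; first exact: hat_fsetU1.
    have [bc| ->] := init_seg_fsetU1 cx bxc; first exact: cQ.
    (* The finitely many [i < rk c] are handled by [Usmall]. For larger [i], either the new node
       lies within [[0, p i)], or the gap pushes [x] to [p i.+1] or beyond, hence past
       [g c (p i)]. *)
    have [ic|ci] := ltnP i (rk c); first by apply: xs Gi; rewrite /= inE /= mem_iota.
    have [xp|px] := ltnP x (p i).
      apply: Q_rk; apply/rkP => y /fset1UP[->//|cy].
      by apply: leq_trans xp; move/rkP: cx => /(_ y cy); lia.
    have cpi : rk c <= p i by exact: leq_trans (p_ge i).
    have pix : p i.+1 <= x.
      by rewrite leqNgt; apply/negP => xpi; apply: (xG i Gi); rewrite px.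
    apply: YQ => //; move: pix; rewrite pS geq_max => /andP[_]; apply: leq_trans.
    by apply: gmP; apply/in_D.
- move=> n; have [i Gi ni] := Ginf n.
  by exists (p i); [exists i|exact: leq_trans (p_ge i)].
- by move=> _ a [i Gi <-] [Ba aQ]; exact: aQ (init_seg_refl a) Gi.
Qed.

End Fusion.

(** * Bounded witnesses for hitting *)

(* The node [a] lies on the last level of the first finite trace of [T] that
   already forces some number into [phi T], and [k] is the bounded witness:
   [h] bounds the witness by the level, and [m] bounds the level by the witness. *)
Lemma locally_finite_hitting : exists (Tt : set {fset nat}) (h m : nat -> nat),
  Utree B U Tt /\ forall T, Utree B U T -> T `<=` Tt ->
    exists a k, [/\ T a, phi T k, k <= h (rk a) & rk a <= m k].
Proof.
have /choice[Ts TsP] (ns : nat * {fset {fset nat}}) : exists T,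
    (ns.2 `<=` D ns.1)%fset -> [/\ Utree B U T,
      [set` ns.2] `<=` T & forall k, k <= ns.1 -> phi T k -> psi ns.2 k].
  case: ns => n s /=.
  have [sD|nsD] := pselect (s `<=` D n)%fset; last by exists setT.
  have [|T TP] := @avoiding_tree n s; last by exists T.
  by move=> a sa; have /in_D[] := fsubsetP sD a sa.
have [n s sD|n s sD|Tt [N [TtU Ninf TtQ]]] := @fusion_tree (fun n s => Ts (n, s)).
- by have [] := TsP (n, s) sD.
- by have [] := TsP (n, s) sD.
have /choice[m mP] k : exists m, N m /\ k <= m.
  by have [n Nn kn] := Ninf k; exists n.
have /choice[h hP] n : exists h, forall s, (s `<=` D n)%fset ->
    psi s !=set0 -> exists2 k, k <= h & psi s k.
  have [||h hP] := @uniform_bound _ (fpowerset (D n))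
    (fun s h => psi s !=set0 -> exists2 k, k <= h & psi s k).
  - move=> s i j ij si /si[k ki sk]; exists k => //; exact: leq_trans ij.
  - move=> s _; have [[k sk]|s0] := pselect (psi s !=set0); last by exists 0 => /s0.
    by exists k => _; exists k.
  - by exists h => s sD; apply: hP; rewrite fpowersetE.
exists Tt, h, m; split=> // T TU TTt; have [TB T0 Td _] := TU.
have phi_psi k : phi T k -> psi (tr (m k) T) k.
  have [Nm km] := mP k; have [_ _ Tsk] := TsP (m k, tr (m k) T) (tr_D _ _).
  move=> Tk; apply: Tsk => //; apply: phi_mon Tk => a Ta.
  apply: (TtQ _ _ Nm (TTt _ Ta) _ (tr_D _ _)).
  have Tc : T (cut (m k) a) by apply: Td Ta _; exact: init_seg_cut.
  by apply/in_tr; split=> //; apply/in_D; split; [exact: TB|exact: rk_cut].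
have [k0 Tk0] := phi_neq0 TU.
have ex_n : exists n, `[< psi (tr n T) !=set0 >].
  by exists (m k0); apply/asboolP; exists k0; exact: phi_psi.
case: (ex_minnP ex_n) => n /asboolP n_neq0 n_min.
case: n n_neq0 n_min => [|n] n_neq0 n_min.
  (* At level 0 the trace has at most the empty node, which is in every tree, so [k] would lie in
     every [phi T']. *)
  have [k k0P] := n_neq0; have [T' T'U] := phi_avoid k; case.
  apply: k0P => // a /in_tr[/in_D[_ a0] _]; have [_ T'0 _ _] := T'U.
  suff -> : a = fset0 by [].
  by apply/fsetP => x; rewrite inE; apply/negP => ax; have /rkP/(_ x ax) := a0.
have [k kh kn] := hP n.+1 _ (tr_D _ _) n_neq0.
have Tk : phi T k by apply: kn => // a /in_tr[].
(* Without a node of rank [n.+1] the traces at [n] and [n.+1] agree, against minimality. *)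
have [a Ta an] : exists2 a, T a & rk a = n.+1.
  apply: contrapT => /forall2NP noa.
  suff : n < n by rewrite ltnn.
  apply: n_min; apply/asboolP; exists k; apply: psi_mon kn.
  apply/fsubsetP => a /in_tr[/in_D[Ba an] Ta]; apply/in_tr; split=> //.
  by apply/in_D; split=> //; have [//|] := noa a; lia.
exists a, k; split=> //; rewrite an //.
by apply: n_min; apply/asboolP; exists k; exact: phi_psi.
Qed.

End Front.

(** * Monotone cofinal maps and the conclusion *)

(** If no value of the new map lay inside [C], the sets [Y] with [f Y] not inside [C] would be
    cofinal, but their images cannot be. *)
Lemma tukey_monotone (S1 S2 : Type) (G : set_system S2) (F : set_system S1) :
  (forall A C : set S2, A `<=` C -> G A -> G C) -> tukey_le G F ->
  exists f : set S1 -> set S2,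
    [/\ forall A C, A `<=` C -> f A `<=` f C, forall A, F A -> G (f A) &
        forall C, G C -> exists2 A, F A & f A `<=` C].
Proof.
move=> Gup [f [fG f_cofinal]].
exists (fun A => \bigcup_(Y in [set Y | F Y /\ Y `<=` A]) f Y); split.
- by move=> A C AC y [Y [FY YA] fYy]; exists Y => //; split=> // x /YA/AC.
- by move=> A FA; apply: Gup (fG A FA) => y fAy; exists A => //; split.
move=> C GC; apply: contrapT => /forall2NP nC.
pose K := [set Y | F Y /\ ~ f Y `<=` C].
have [|_ /(_ C GC)[_ [Y [_ nYC] <-]]] := f_cofinal K; last by [].
split=> [Y []//|A FA]; have [//|/existsNP[y /not_implyP[[Y [FY YA] fYy] nCy]]] := nC A.
by exists Y => //; split=> // /(_ _ fYy).
Qed.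

Theorem theorem5p1 (B : set {fset nat}) (U : {fset nat} -> set_system nat)
    (V : set_system nat)
    (hB : flat_top_front B)
    (hU : forall c, hatm B c -> nonprincipal (U c) /\ p_point (U c))
    (hV : q_point V)
    (hVU : tukey_le V (tree_ultrafilter B U)) :
  exists (Tt : set {fset nat}) (tau : {fset nat} -> nat),
    [/\ Utree B U Tt,
        finite_to_one_on Tt tau &
        [set tau @` T | T in [set T | Utree B U T /\ T `<=` Tt]] `<=` V].
Proof.
have [frontB _ _] := hB; have [VU Vnp _] := hV.
have [|f [f_mon fV f_cofinal]] := tukey_monotone _ hVU.
  by move=> A C AC; exact: filterS.
pose phi T := f (T `&` B).
have phi_mon T T' : T `<=` T' -> phi T `<=` phi T'.
  by move=> TT'; apply: f_mon => a [/TT'].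
have phiV T : Utree B U T -> V (phi T).
  by move=> TU; apply: fV; split=> [a []//|]; exists T.
have phi_cofinal C : V C -> exists2 T, Utree B U T & phi T `<=` C.
  move=> VC; have [A [_ [T TU TA]] fAC] := f_cofinal C VC.
  by exists T => // y /(f_mon _ _ TA)/fAC.
have [||Tt [h [m [TtU TtP]]]] := locally_finite_hitting frontB hU phi_mon.
- by move=> T TU; exact: filter_ex (phiV T TU).
- move=> k; have [T TU Tk] := phi_cofinal _ (nonprincipal_tail VU Vnp k.+1).
  by exists T => // /Tk /=; rewrite ltnn.
(* This bound dominates [h (rk a)] whenever [rk a <= m k], so no later point of [W] is a bounded
   witness for the same [a]. *)
have [W VW Wsparse] := q_point_sparse (fun k => \max_(r < (m k).+1) h r) hV.
have [T0 T0U T0W] := phi_cofinal W VW.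
pose R a k := [/\ W k, k <= h (rk a) & rk a <= m k].
have R_uniq a k k' : R a k -> R a k' -> k = k'.
  have le k1 k2 : R a k1 -> R a k2 -> k2 <= k1.
    move=> [Wk1 _ ak1] [Wk2 k2a _]; rewrite leqNgt; apply/negP => k12.
    have := Wsparse k1 k2 Wk1 Wk2 k12.
    have := leq_bigmax (Ordinal (ak1 : rk a < (m k1).+1)) (F := fun r : 'I__ => h r).
    by move=> /=; lia.
  by move=> ak ak'; apply/eqP; rewrite eqn_leq !le.
(* The default [rk a] keeps the bound on [rk a] in terms of [tau a], which makes [tau]
   finite-to-one. *)
have /choice[tau tauP] a : exists t,
    (forall k, R a k -> t = k) /\ rk a <= maxn t (m t).
  have [[k ak]|nR] := pselect (exists k, R a k).
    exists k; split; first by move=> k'; exact: R_uniq.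
    by have [_ _ akm] := ak; rewrite leq_max akm orbT.
  by exists (rk a); split; [move=> k ak; case: nR; exists k|rewrite leq_maxl].
exists (Tt `&` T0), tau; split; first exact: (Utree_setI hU).
  move=> y; apply: sub_finite_set (finite_rk (maxn y (m y))) => a [_ <-].
  exact: (tauP a).2.
move=> _ [T [TU TTt] <-].
have [//|VC] := in_ultra_setVsetC (tau @` T) VU.
(* Hitting for [T] intersected with [T1] gives a node [a] of [T] with [tau a] in [phi T1], which
   avoids the image of [T]. *)
have [T1 T1U T1C] := phi_cofinal _ VC.
have [||a [k [[Ta _] kT ka ak]]] := TtP (T `&` T1).
- exact: (Utree_setI hU).
- by move=> a [/TTt[]].
case: (T1C k); first by apply: phi_mon kT => b [].
exists a => //; apply: (tauP a).1; split=> //.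
by apply: T0W; apply: phi_mon kT => b [/TTt[]].
Qed.
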